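(* Let $G$ be a finite simple undirected graph. Then $$\text{2-}\eta_{A}(G)\leq \theta(G)-\tau(G)+\mathrm{v}_\mathrm{o}(G)+2\mathrm{c}_\mathrm{e}(G)-\mathrm{c}(G)+2i(G),$$ $$\text{2-}\eta_{A+I}(G)\leq \theta(G)-\tau(G)+\mathrm{v}_\mathrm{e}(G)+\mathrm{c}(G).$$
   Context: $A(G)$ is the adjacency matrix of $G$, viewed over $\mathbb{F}_2$, and $I$ the identity; $\text{2-}\eta_{N}(G)$ denotes the dimension of the kernel of the matrix $N$ over $\mathbb{F}_2$. $\mathrm{v}(G),\mathrm{e}(G),\mathrm{c}(G)$ are the numbers of vertices, edges, connected components; $\mathrm{v}_\mathrm{e}(G)$, $\mathrm{v}_\mathrm{o}(G)$ the numbers of even-degree and odd-degree vertices; a graph is even if all its vertices have even degree; $\mathrm{c}_\mathrm{e}(G)$ is the number of connected components that are even; $i(G)=0$ if $G$ is even and $i(G)=1$ otherwise. $\theta(G)=\mathrm{e}(G)-\mathrm{v}(G)+\mathrm{c}(G)$ is the circuit rank. A cycle is odd if it has an odd number of edges; two cycles are disjoint if they share no edge; $\tau(G)$ is the maximum cardinality of a set of pairwise disjoint odd cycles of $G$. *)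

(* Defs.v *)
(* A finite simple undirected graph is a symmetric irreflexive relation
   e : rel V on a finite type V; the definitions below are meant for such e. *)
From mathcomp Require Import all_boot all_order all_algebra.

Set Implicit Arguments.
Unset Strict Implicit.
Unset Printing Implicit Defensive.

Import GRing.Theory.
Local Open Scope ring_scope.

Section Graph.

Variables (V : finType) (e : rel V).

Definition adjmx : 'M['F_2]_#|V| :=
  \matrix_(i, j) (e (enum_val i) (enum_val j))%:R.

(* kermx is the left kernel, so the transpose makes this the dimension of
   {x | N x = 0}. *)
Definition nullity2 (n : nat) (N : 'M['F_2]_n) : nat := \rank (kermx N^T).

Definition edges : {set {set V}} :=
  [set E | [exists x, [exists y, e x y && (E == [set x; y])]]].

Definition components : {set {set V}} :=
  equivalence_partition (connect e) [set: V].

Definition deg (x : V) : nat := #|[set y | e x y]|.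

Definition nv : nat := #|V|.
Definition ne : nat := #|edges|.
Definition nc : nat := #|components|.
Definition nv_even : nat := #|[set x | ~~ odd (deg x)]|.
Definition nv_odd : nat := #|[set x | odd (deg x)]|.

(* A vertex has the same degree in G and in its component. *)
Definition nc_even : nat :=
  #|[set C in components | [forall x in C, ~~ odd (deg x)]]|.

Definition even_graph : bool := [forall x, ~~ odd (deg x)].
Definition i_graph : nat := if even_graph then 0 else 1.

Definition circuit_rank : int := ne%:Z - nv%:Z + nc%:Z.

(* A cycle is a closed walk through at least three pairwise distinct vertices,
   taken up to rotation and reversal: it is identified with its edge set. *)
Definition cycle_edges (p : seq V) : {set {set V}} :=
  [set [set x; next p x] | x in p].

Definition is_cycle (C : {set {set V}}) : bool :=
  [exists n : 'I_#|V|.+1, [exists p : n.-tuple V,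
     [&& (2 < size p)%N, cycle e p, uniq p & C == cycle_edges p]]].

(* The bound on the length in is_cycle is harmless. *)
Lemma is_cycleP (C : {set {set V}}) :
  reflect (exists p : seq V,
             [/\ (2 < size p)%N, cycle e p, uniq p & C = cycle_edges p])
          (is_cycle C).
Proof.
apply: (iffP existsP) => [[n /existsP[p /and4P[p3 ep up /eqP->]]]|].
  by exists p.
case=> p [p3 ep up ->].
have szp : (size p < #|V|.+1)%N by rewrite ltnS -(card_uniqP up) max_card.
exists (Ordinal szp); apply/existsP; exists (in_tuple p).
exact/and4P.
Qed.

Definition odd_cycle (C : {set {set V}}) : bool := is_cycle C && odd #|C|.

(* Since cycles are edge sets, trivIset S says that distinct cycles of S share
   no edge. *)
Definition tau : nat :=
  \max_(S : {set {set {set V}}} | [forall C in S, odd_cycle C] && trivIset S)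
    #|S|.

End Graph.

(* Main.v *)
(* Let B be the vertex-edge incidence matrix over F_2 and E_S the matrix whose
   columns are the indicators of the vertices in S.  With M = [B | E_S], the
   matrix M M^T = B B^T + E_S E_S^T is A(G) when S is the set of odd vertices
   and A(G) + I when S is the set of even vertices.  The left kernel of M
   consists of the functions that are constant on components and vanish on S,
   so M has rank at least v - c_S, where c_S counts the components avoiding S.
   A family of t edge-disjoint odd cycles gives t rows K orthogonal to M with
   K K^T = I; Sylvester's rank inequality applied to the product of [M; K] and
   its transpose then yields rank (M M^T) >= 2 rank M + t - (e + |S|). *)
Require Import Defs.
From mathcomp Require Import all_boot all_order all_algebra.
From mathcomp Require Import zify.

Set Implicit Arguments.
Unset Strict Implicit.
Unset Printing Implicit Defensive.

Import GRing.Theory.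
Local Open Scope ring_scope.

(** * Arithmetic over F_2 and ranks of Gram matrices *)

Lemma natr_F2 (n : nat) : n%:R = (odd n)%:R :> 'F_2.
Proof.
rewrite -{1}(odd_double_half n) natrD -mul2n natrM.
by rewrite (_ : 2%:R = 0 :> 'F_2) ?mul0r ?addr0 //; apply: val_inj.
Qed.

Lemma addr_eq0_F2 (a b : 'F_2) : (a + b == 0) = (a == b).
Proof. by rewrite addr_eq0 oppr_pchar2 ?pchar_Fp. Qed.

Lemma sum_boolr (R : pzSemiRingType) (I : finType) (A : {set I}) (P : pred I) :
  \sum_(i in A) (P i)%:R = #|[set i in A | P i]|%:R :> R.
Proof.
rewrite -natr_sum -big_mkcondr sum1_card; congr _%:R.
by apply: eq_card => i; rewrite !inE.
Qed.

(** Since [K *m K^T] is the identity, [K] has rank [t] and its row space meets that of [M] only in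
    0, so [col_mx M K] has rank [\rank M + t]. Its Gram matrix is block diagonal with blocks
    [M *m M^T] and the identity, and Sylvester's inequality gives the bound. *)
Lemma mxrank_gram_lower_bound (F : fieldType) (m n t : nat)
    (M : 'M[F]_(m, n)) (K : 'M[F]_(t, n)) :
  K *m K^T = 1%:M -> M *m K^T = 0 ->
  (2 * \rank M + t <= \rank (M *m M^T) + n)%N.
Proof.
move=> KK MK.
have KM : K *m M^T = 0 by rewrite -[K]trmxK -trmx_mul MK trmx0.
have rK : \rank K = t.
  apply/eqP; rewrite eqn_leq rank_leq_row -{1}(mxrank1 F t) -KK.
  exact: mxrankM_maxl.
have capMK : (M :&: K)%MS = 0.
  apply/eqP/rowV0P => v; rewrite sub_capmx => /andP[/submxP[a va] /submxP[b vb]].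
  have: v *m K^T = 0 by rewrite va -mulmxA MK mulmx0.
  by rewrite {1}vb -mulmxA KK mulmx1 => b0; rewrite vb b0 mul0mx.
have rN : \rank (col_mx M K) = (\rank M + t)%N.
  by rewrite -addsmxE -[in RHS]rK -mxrank_sum_cap capMK mxrank0 addn0.
have := mxrank_mul_min (col_mx M K) (col_mx M K)^T.
rewrite mxrank_tr rN tr_col_mx mul_col_row KK MK KM rank_diag_block_mx mxrank1.
lia.
Qed.

(** * The incidence matrix and its Gram matrix *)

Section Incidence.

Variables (V : finType) (e : rel V).
Hypotheses (e_sym : symmetric e) (e_irr : irreflexive e).

Lemma edgesP (E : {set V}) :
  reflect (exists x y, e x y /\ E = [set x; y]) (E \in edges e).
Proof.
rewrite inE; apply: (iffP existsP) => [[x /existsP[y /andP[exy /eqP->]]]|].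
  by exists x, y.
by case=> x [y [exy ->]]; exists x; apply/existsP; exists y; rewrite exy eqxx.
Qed.

Lemma card_edges_at (x : V) : #|[set E in edges e | x \in E]| = deg e x.
Proof.
have inj : {in [set y | e x y] &, injective (fun y => [set x; y])}.
  move=> y z; rewrite !inE => exy exz /setP/(_ y).
  rewrite !inE eqxx orbT => /esym/orP[/eqP yx|/eqP//].
  by rewrite yx e_irr in exy.
rewrite /deg -(card_in_imset inj); apply: eq_card => E; rewrite inE.
apply/andP/imsetP => [[/edgesP[u [v [euv ->]]]]|[y]].
  rewrite !inE => /orP[/eqP->|/eqP->]; first by exists v; rewrite ?inE.
  by exists u; rewrite ?inE 1?e_sym // setUC.
rewrite inE => exy ->; split; last by rewrite !inE eqxx.
by apply/edgesP; exists x, y.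
Qed.

Lemma card_edges_between (x y : V) : x != y ->
  #|[set E in edges e | (x \in E) && (y \in E)]| = e x y.
Proof.
move=> xy; have edge_xy E : E \in edges e -> x \in E -> y \in E ->
    e x y /\ E = [set x; y].
  case/edgesP=> u [v [euv ->]]; rewrite !inE.
  case/orP=> /eqP xe /orP[] /eqP ye; subst; rewrite ?eqxx // in xy *.
  by rewrite e_sym setUC.
case exy: (e x y).
  rewrite -[RHS](cards1 [set x; y]); apply: eq_card => E; rewrite !in_set1 inE.
  apply/and3P/eqP => [[? ? ?]|->]; first by have [] := edge_xy E.
  by split; [apply/edgesP; exists x, y | rewrite !inE eqxx | rewrite !inE eqxx orbT].
apply: eq_card0 => E; rewrite inE; apply/and3P => -[Ee xE yE].
by have [] := edge_xy E Ee xE yE; rewrite exy.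
Qed.

Definition incmx : 'M['F_2]_(#|V|, #|edges e|) :=
  \matrix_(i < #|V|, j < #|edges e|) (enum_val i \in enum_val j)%:R.

Definition pointmx (S : {set V}) : 'M['F_2]_(#|V|, #|S|) :=
  \matrix_(i < #|V|, j < #|S|) (enum_val i == enum_val j)%:R.

Definition cyclemx (F : {set {set {set V}}}) : 'M['F_2]_(#|F|, #|edges e|) :=
  \matrix_(i < #|F|, j < #|edges e|) (enum_val j \in enum_val i)%:R.

(** Over F_2 each entry is the parity of a count: edges through both vertices, plus points of [S]
    equal to both. The second count lives on the diagonal, where the first is the degree. *)
Lemma gram_incmxE (S : {set V}) (i j : 'I_#|V|) :
  (row_mx incmx (pointmx S) *m (row_mx incmx (pointmx S))^T) i j =
    if i == j then (odd (deg e (enum_val i)) (+) (enum_val i \in S))%:R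
    else (e (enum_val i) (enum_val j))%:R.
Proof.
set x := enum_val i; set y := enum_val j.
have xyE : (i == j) = (x == y) by rewrite (inj_eq enum_val_inj).
rewrite tr_row_mx mul_row_col !mxE.
have -> : \sum_k incmx i k * incmx^T k j =
    #|[set E in edges e | (x \in E) && (y \in E)]|%:R.
  rewrite -sum_boolr [RHS]big_enum_val; apply: eq_bigr => k _.
  by rewrite !mxE -natrM mulnb.
have -> : \sum_k pointmx S i k * (pointmx S)^T k j =
    #|[set z in S | (x == z) && (y == z)]|%:R.
  rewrite -sum_boolr [RHS]big_enum_val; apply: eq_bigr => k _.
  by rewrite !mxE -natrM mulnb.
rewrite xyE; case: eqP => [<-|/eqP xy].
  rewrite (_ : #|_| = deg e x); last first.
    by rewrite -card_edges_at; apply: eq_card => E; rewrite !inE andbb.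
  rewrite (_ : #|[set z in S | _]| = (x \in S)); last first.
    case xS: (x \in S).
      rewrite -[RHS](cards1 x); apply: eq_card => z; rewrite !inE andbb eq_sym.
      by case: eqP => [->|]; rewrite ?xS ?andbF.
    apply: eq_card0 => z; rewrite !inE andbb.
    by case: eqP => [<-|]; rewrite ?xS ?andbF.
  by rewrite -natrD natr_F2 oddD oddb.
rewrite card_edges_between // (_ : #|_| = 0%N) ?addr0 //.
apply: eq_card0 => z; rewrite !inE.
by case: (x =P z) => [<-|_] /=; rewrite ?[y == x]eq_sym ?(negbTE xy) andbF.
Qed.

(** * The left kernel of the extended incidence matrix *)

Definition avoiding (S : {set V}) : {set {set V}} :=
  [set C in components e | [disjoint C & S]].

(** A left kernel vector is a function on vertices: the column of an edge forces equal values at its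
    ends, and the column of a point of [S] forces the value 0 there. *)
Lemma rank_incmx (S : {set V}) :
  (#|V| <= \rank (row_mx incmx (pointmx S)) + #|avoiding S|)%N.
Proof.
set M := row_mx _ _.
(* The rows of [P] are the indicators of the components avoiding [S]; once their span contains the
   kernel, their number bounds its dimension. *)
pose P : 'M['F_2]_(#|avoiding S|, #|V|) :=
  \matrix_(i < #|avoiding S|, j < #|V|) (enum_val j \in enum_val i)%:R.
suff /mxrankS : (kermx M <= P)%MS.
  by rewrite mxrank_ker => /leq_trans/(_ (rank_leq_row P)); lia.
apply/rV_subP => u /sub_kermxP; rewrite mul_mx_row -row_mx0 => /eq_row_mx[uB uE].
pose f v := u 0 (enum_rank v).
have sumE (g : V -> 'F_2) : \sum_k u 0 k * g (enum_val k) = \sum_v f v * g v.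
  by rewrite [RHS]big_enum_val; apply: eq_bigr => k _; rewrite /f enum_valK.
have f_edge x y : e x y -> f x = f y.
  move=> exy; have Exy : [set x; y] \in edges e by apply/edgesP; exists x, y.
  have xy : x != y by apply: contraTneq exy => ->; rewrite e_irr.
  apply/eqP; rewrite -addr_eq0_F2.
  move/matrixP/(_ 0 (enum_rank_in Exy [set x; y])): uB; rewrite !mxE.
  have -> : \sum_k u 0 k * incmx k (enum_rank_in Exy [set x; y]) =
      \sum_z f z * (z \in [set x; y])%:R.
    by rewrite -sumE; apply: eq_bigr => k _; rewrite mxE enum_rankK_in.
  rewrite (bigD1 x) //= (bigD1 y) ?[y == x]eq_sym //= !inE !eqxx orbT !mulr1.
  rewrite big1 => [|z]; first by rewrite addr0 => /eqP.
  by rewrite !inE => /andP[/negbTE-> /negbTE->]; rewrite mulr0.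
have f_connect x y : connect e x y -> f x = f y.
  case/connectP=> p; elim: p x => [|z p IHp] x /=; first by move=> _ ->.
  by case/andP=> /f_edge-> zp /(IHp _ zp).
have f_S x : x \in S -> f x = 0.
  move=> xS; move/matrixP/(_ 0 (enum_rank_in xS x)): uE; rewrite !mxE.
  have -> : \sum_k u 0 k * pointmx S k (enum_rank_in xS x) =
      \sum_z f z * (z == x)%:R.
    by rewrite -sumE; apply: eq_bigr => k _; rewrite mxE enum_rankK_in.
  rewrite (bigD1 x) //= eqxx mulr1 big1 ?addr0 // => z /negbTE->.
  by rewrite mulr0.
have conn_equiv : {in [set: V] & &, equivalence_rel (connect e)}.
  move=> x y z _ _ _; split=> [|xy]; first exact: connect0.
  by rewrite (same_connect (sym_connect_sym e_sym) xy).
have /and3P[/eqP covV trivV _] := equivalence_partitionP conn_equiv.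
have in_block x y : (y \in pblock (components e) x) = connect e x y.
  by rewrite (pblock_equivalence_partition conn_equiv) ?inE.
have block_comp x : pblock (components e) x \in components e.
  by rewrite pblock_mem // covV inE.
(* The constant value of [f] on a component; the default 0 concerns only the empty set, which is no
   component. *)
pose a (C : {set V}) := if [pick x in C] is Some x then f x else 0.
apply/submxP; exists (\row_i a (enum_val i)); apply/rowP => j; rewrite !mxE.
under eq_bigr => i _ do rewrite !mxE.
rewrite -(big_enum_val (fun C => a C * (enum_val j \in C)%:R)) /=.
have -> : u 0 j = f (enum_val j) by rewrite /f enum_valK.
set x := enum_val j; set C := pblock (components e) x.
have xC : x \in C by rewrite in_block connect0.
have other D : D \in components e -> D != C -> x \in D = false.
  by move=> DP; apply: contraNF => xD; rewrite /C (def_pblock trivV DP xD).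
(* If the component of [x] avoids [S], only its term survives; otherwise every term vanishes, and so
   does [f x], since [x] is connected to a point of [S]. *)
have [CS|] := boolP (C \in avoiding S).
  rewrite (bigD1 C) //= xC mulr1 big1 ?addr0 => [|D /andP[]].
    rewrite /a; case: pickP => [y|/(_ x)]; last by rewrite xC.
    by rewrite in_block => /f_connect.
  by rewrite inE => /andP[DP _] /(other _ DP) ->; rewrite mulr0.
move=> CS; rewrite big1 => [|D DS].
  move: CS; rewrite inE block_comp /= => /pred0Pn[y /andP[/= yC yS]].
  by rewrite in_block in yC; rewrite (f_connect _ _ yC) f_S.
rewrite other ?mulr0 //; first by move: DS; rewrite inE => /andP[].
by apply: contraNneq CS => <-.
Qed.

(** * Cycles and their incidence vectors *)

Lemma cycle_sub_edges (C : {set {set V}}) : is_cycle e C -> C \subset edges e.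
Proof.
case/is_cycleP=> p [_ ep _ ->]; apply/subsetP => _ /imsetP[x xp ->].
by apply/edgesP; exists x, (next p x); split=> //; apply: next_cycle.
Qed.

(** Ensures that a cycle does not run through one edge twice, as a closed walk of length two
    would. *)
Lemma next_next_neq (p : seq V) (x : V) :
  uniq p -> (2 < size p)%N -> x \in p -> next p (next p x) != x.
Proof.
move=> up p3 /rot_to[i q pE].
have uq : uniq (x :: q) by rewrite -pE rot_uniq.
have : (2 < size (x :: q))%N by rewrite -pE size_rot.
rewrite -!(next_rot i up) pE.
case: q uq {pE} => [|y [|z q]] //= /and3P[]; rewrite !inE !negb_or.
by move=> /and3P[xy xz _] _ _ _; rewrite !eqxx [y == x]eq_sym (negbTE xy) eq_sym.
Qed.

(** Each edge of the cycle is counted from its starting vertex; [x] starts as many edges as it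
    ends. *)
Lemma cycle_even_at (C : {set {set V}}) (x : V) :
  is_cycle e C -> ~~ odd #|[set E in C | x \in E]|.
Proof.
case/is_cycleP=> p [p3 ep up ->].
have next_neq y : y \in p -> y != next p y.
  move=> yp; have := next_cycle ep yp; apply: contraTneq => <-.
  by rewrite e_irr.
(* Equal edges from distinct [y] and [z] would force [y = next p z] and [z = next p y]. *)
have inj : {in p &, injective (fun y => [set y; next p y])}.
  move=> y z yp zp /= /setP yz.
  have := yz y; rewrite !inE eqxx /= => /esym/orP[/eqP//|/eqP yE].
  have := yz z; rewrite !inE eqxx /= => /orP[/eqP//|/eqP zE].
  by have := next_next_neq up p3 yp; rewrite -zE -yE eqxx.
have -> : #|[set E in cycle_edges p | x \in E]| =
    (\sum_(y in p) ((x == y) + (x == next p y)))%N.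
  rewrite -sum1_card (eq_bigl _ _ (in_set _)) big_mkcondr big_imset //=.
  apply: eq_bigr => y yp; rewrite !inE.
  case: eqP => [->|_]; first by rewrite (negbTE (next_neq y yp)).
  by case: eqP.
rewrite big_split /=.
(* [next p] permutes [p], with inverse [prev p]. *)
have -> : (\sum_(y in p) (x == next p y) = \sum_(y in p) (x == y))%N.
  rewrite [RHS](reindex_onto (next p) (prev p)) /=.
    by apply: eq_bigl => y; rewrite mem_next prev_next // eqxx andbT.
  by move=> y _; rewrite next_prev.
by rewrite addnn odd_double.
Qed.

(** Entries are parities of numbers of common edges: odd on the diagonal, zero off it by
    disjointness. *)
Lemma cyclemx_ortho (F : {set {set {set V}}}) :
  [forall C in F, odd_cycle e C] -> trivIset F ->
  cyclemx F *m (cyclemx F)^T = 1%:M.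
Proof.
move=> /'forall_implyP oddF trivF; apply/matrixP => i j; rewrite !mxE.
have /andP[cycC oddC] := oddF _ (enum_valP i).
transitivity (#|enum_val i :&: enum_val j|%:R : 'F_2).
  rewrite (_ : _ :&: _ = [set E in edges e |
      (E \in enum_val i) && (E \in enum_val j)]).
    rewrite -sum_boolr [RHS]big_enum_val; apply: eq_bigr => k _.
    by rewrite !mxE -natrM mulnb.
  apply/setP=> E; rewrite in_setI [RHS]inE; case: (boolP (E \in enum_val i)) => //.
  - by move=> /(subsetP (cycle_sub_edges cycC)) ->.
  - by rewrite andbF.
have [<-|ij] := eqVneq i j; first by rewrite setIid natr_F2 oddC.
have /eqP -> : enum_val i :&: enum_val j == set0.
  rewrite setI_eq0; apply: (trivIsetP trivF); try exact: enum_valP.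
  by rewrite (inj_eq enum_val_inj).
by rewrite cards0.
Qed.

(** Each entry is the parity of the number of edges of a cycle at a vertex, which is even by
    [cycle_even_at]. *)
Lemma incmx_cyclemx (F : {set {set {set V}}}) :
  [forall C in F, odd_cycle e C] -> incmx *m (cyclemx F)^T = 0.
Proof.
move=> /'forall_implyP oddF; apply/matrixP => i j; rewrite !mxE.
have /andP[cycC _] := oddF _ (enum_valP j).
transitivity (#|[set E in enum_val j | enum_val i \in E]|%:R : 'F_2).
  rewrite (_ : [set E in _ | _] = [set E in edges e |
      (enum_val i \in E) && (E \in enum_val j)]).
    rewrite -sum_boolr [RHS]big_enum_val; apply: eq_bigr => k _.
    by rewrite !mxE -natrM mulnb.
  apply/setP=> E; rewrite [LHS]inE [RHS]inE andbC.
  case: (boolP (E \in enum_val j)) => [/(subsetP (cycle_sub_edges cycC)) ->|_].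
    by rewrite andbT.
  by rewrite !andbF.
by rewrite natr_F2 (negbTE (cycle_even_at _ cycC)).
Qed.

(** * The nullity bounds *)

Lemma nullity_gram (S : {set V}) (N : 'M['F_2]_#|V|) :
  N = row_mx incmx (pointmx S) *m (row_mx incmx (pointmx S))^T ->
  (nullity2 N + tau e + nv V <= ne e + #|S| + 2 * #|avoiding S|)%N.
Proof.
move=> NE; have rM := rank_incmx S.
pose family_ok (F : {set {set {set V}}}) :=
  [forall C in F, odd_cycle e C] && trivIset F.
(* The empty family is admissible, so the maximum [tau e] is attained. *)
have family_ok_ex : (0 < #|family_ok|)%N.
  apply/card_gt0P; exists set0; apply/andP; split.
    by apply/'forall_implyP => C; rewrite inE.
  by apply/trivIsetP => C D; rewrite inE.
have [F /andP[oddF trivF] tauE] :=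
  eq_bigmax_cond (fun F : {set {set {set V}}} => #|F|) family_ok_ex.
(* Zero columns over the points of [S] preserve both orthogonality relations. *)
pose K := row_mx (cyclemx F) (0 : 'M_(_, #|S|)).
have := @mxrank_gram_lower_bound _ _ _ _ (row_mx incmx (pointmx S)) K.
rewrite tr_row_mx trmx0 !mul_row_col !mulmx0 !addr0.
rewrite cyclemx_ortho // incmx_cyclemx // => /(_ erefl erefl).
rewrite -NE /nullity2 mxrank_ker mxrank_tr /nv /ne.
rewrite (tauE : tau e = #|F|).
(* The nullity is now a truncated difference [#|V| - \rank N]; this bound makes it a true one. *)
have := rank_leq_row N; lia.
Qed.

End Incidence.

Theorem theorem9 (V : finType) (e : rel V)
    (e_sym : symmetric e) (e_irr : irreflexive e) :
  (nullity2 (adjmx e))%:Z <=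
    circuit_rank e - (tau e)%:Z + (nv_odd e)%:Z + 2 * (nc_even e)%:Z
      - (nc e)%:Z + 2 * (i_graph e)%:Z
  /\
  (nullity2 (adjmx e + 1%:M))%:Z <=
    circuit_rank e - (tau e)%:Z + (nv_even e)%:Z + (nc e)%:Z.
Proof.
split.
  have : adjmx e = row_mx (incmx e) (pointmx [set x | odd (deg e x)]) *m
      (row_mx (incmx e) (pointmx [set x | odd (deg e x)]))^T.
    apply/matrixP => i j; rewrite gram_incmxE // mxE inE addbb.
    by case: eqP => [->|//]; rewrite e_irr.
  move/(nullity_gram e_sym e_irr).
  have -> : #|avoiding e [set x | odd (deg e x)]| = nc_even e.
    apply: eq_card => C; rewrite !inE; congr andb.
    rewrite disjoint_subset; apply/subsetP/'forall_implyP => H x /H;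
      by rewrite !inE.
  (* The [nc e] inside the circuit rank cancels the subtracted one. *)
  rewrite /circuit_rank /nv_odd; lia.
have : adjmx e + 1%:M =
    row_mx (incmx e) (pointmx [set x | ~~ odd (deg e x)]) *m
      (row_mx (incmx e) (pointmx [set x | ~~ odd (deg e x)]))^T.
  apply/matrixP => i j; rewrite gram_incmxE // !mxE inE addbN addbb.
  by case: eqP => [->|_]; rewrite ?e_irr ?add0r ?addr0.
move/(nullity_gram e_sym e_irr).
(* The bound on the nullity then contains [2 * nc e], one copy of which belongs to the circuit
   rank. *)
have : (#|avoiding e [set x | ~~ odd (deg e x)]| <= nc e)%N.
  by apply/subset_leq_card/subsetP => C; rewrite inE => /andP[].
rewrite /circuit_rank /nv_even /nv; lia.
Qed.
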